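(* Consider a finite action-controlled hidden Markov model with action set $\mathcal A$, initial distribution $\pi_0$, emission matrix $E$, and transition matrices $T(a)=P(a)$, $a\in\mathcal A$, where each $P(a)\in\mathbb R^{N\times N}$ is a permutation matrix. Then for every initialization $w_0\in\mathbb R^N$ there is a mapping $\psi$ (depending on the model and on $w_0$), taking as input the time step and the most recent observation-action pair, such that the recursion $$\boldsymbol w_k=P(\boldsymbol a_{k-1})\boldsymbol w_{k-1}+\psi(k,\boldsymbol y_k,\boldsymbol a_{k-1}),\qquad k\ge1,$$ started at $w_0$, reproduces the optimal logits: $\boldsymbol w_k=\boldsymbol w_k^o$ for all $k\ge1$ and all observation and action sequences.
   Context: Action-controlled hidden Markov model: states $x_1,\dots,x_N$, finite action set $\mathcal A$, $\boldsymbol x^\star_0\sim\pi_0$, transition matrices $T(a)$ with entries $t_{ij}(a)=\mathbb P(\boldsymbol x^\star_{k+1}=x_i\mid\boldsymbol x^\star_k=x_j,\boldsymbol a_k=a)$; observations $\boldsymbol y_k\in\{u_1,\dots,u_S\}$ (canonical basis vectors of $\mathbb R^S$), $k\ge1$, with emission matrix $E\in\mathbb R^{S\times N}$, $e_{ij}=\mathbb P(\boldsymbol y_k=u_i\mid\boldsymbol x^\star_k=x_j)$. Optimal logits: $\boldsymbol w_0^o=\log\pi_0$ and $\boldsymbol w_k^o=\log\big(T(\boldsymbol a_{k-1})\exp(\boldsymbol w^o_{k-1})\big)+\log(E^\top\boldsymbol y_k)$, with $\log,\exp$ entrywise. The softmax of $\boldsymbol w_k^o$ is the belief vector $\mathbb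 P(\boldsymbol x_k^\star=\cdot\mid\boldsymbol y_{1:k},\boldsymbol a_{0:k-1})$. Conventions: $\log0=-\infty$, $\exp(-\infty)=0$, $-\infty\cdot0=0$; logits and values of $\psi$ lie in $[-\infty,\infty)^N$. *)

(* Defs.v *)
From HB Require Import structures.
From mathcomp Require Export all_boot all_order all_algebra.
From mathcomp Require Export reals constructive_ereal exp.

Set Implicit Arguments.
Unset Strict Implicit.
Unset Printing Implicit Defensive.

Import Order.TTheory GRing.Theory Num.Theory.
Local Open Scope ring_scope.

Section Defs.
Variable R : realType.

(* Distributions are columns, so stochastic matrices have columns summing to 1:
   [trans a i j] is P(x_{k+1} = x_i | x_k = x_j, a_k = a) and
   [emission i j] is P(y_k = u_i | x_k = x_j). *)
Definition col_stochastic m n (M : 'M[R]_(m, n)) : Prop :=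
  (forall i j, 0 <= M i j) /\ (forall j, \sum_(i < m) M i j = 1).

Record hmm (N S : nat) (A : finType) : Type := HMM {
  init : 'cV[R]_N;
  trans : A -> 'M[R]_N;
  emission : 'M[R]_(S, N);
  init_stochastic : col_stochastic init;
  trans_stochastic : forall a, col_stochastic (trans a);
  emission_stochastic : col_stochastic emission
}.

(* Observations are the canonical basis vectors of R^S. *)
Definition is_obs S (y : 'cV[R]_S) : Prop :=
  exists i : 'I_S, y = delta_mx i ord0.

Definition to_ereal N (v : 'cV[R]_N) : 'cV[\bar R]_N := map_mx EFin v.

(* [lne 0 = -oo] and [expeR -oo = 0]. *)
Definition vlog N (v : 'cV[\bar R]_N) : 'cV[\bar R]_N := map_mx (@lne R) v.
Definition vexp N (v : 'cV[\bar R]_N) : 'cV[\bar R]_N := map_mx (@expeR R) v.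

(* [\bar R] is not a semiring, so [*m] does not apply to extended vectors;
   the extended product satisfies [0 * -oo = 0]. *)
Definition emulv m n (M : 'M[R]_(m, n)) (v : 'cV[\bar R]_n) : 'cV[\bar R]_m :=
  \col_i (\sum_(j < n) ((M i j)%:E * v j ord0))%E.

Section Logits.
Variables (N S : nat) (A : finType) (H : hmm N S A).
Variables (y : nat -> 'cV[R]_S) (a : nat -> A).

(* [y 0] is never used: observations start at time 1. *)
Fixpoint opt_logits (k : nat) : 'cV[\bar R]_N :=
  match k with
  | 0%N => vlog (to_ereal (init H))
  | k'.+1 => vlog (emulv (trans H (a k')) (vexp (opt_logits k')))
             + vlog (to_ereal ((emission H)^T *m y k'.+1))
  end.

End Logits.
End Defs.

(* Main.v *)
(* For a permutation matrix P, P v is the reindexed vector i |-> v (s i), so it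
   commutes with entrywise maps and log (P exp v) = P v: the optimal recursion
   is already linear with additive input log (E^T y_k). The only discrepancy is
   the initialization, which psi corrects at time 1 by adding
   P(a_0) (log pi_0 - w_0); since w_0 is finite, this makes sense even where
   log pi_0 = -oo. *)
Require Import Defs.
From mathcomp Require Import all_boot all_order perm all_algebra.
From mathcomp Require Import reals constructive_ereal exp.
Import Order.TTheory GRing.Theory Num.Theory.
Local Open Scope ring_scope.

Lemma emulv_perm_mx (R : realType) (N : nat) (s : 'S_N) (v : 'cV[\bar R]_N) :
  emulv (perm_mx s) v = row_perm s v.
Proof.
apply/colP => i; rewrite !mxE (bigD1 (s i)) //= big1 => [|j /negPf neq_j].
  by rewrite !mxE eqxx mul1e addr0.
by rewrite !mxE eq_sym neq_j mul0e.
Qed.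

Lemma vlog_emulv_vexp (R : realType) (N : nat) (M : 'M[R]_N)
    (v : 'cV[\bar R]_N) :
  is_perm_mx M -> vlog (emulv M (vexp v)) = emulv M v.
Proof.
case/is_perm_mxP => s ->; rewrite !emulv_perm_mx.
by apply/colP => i; rewrite !mxE expeRK.
Qed.

(** Extended multiplication by a real need not distribute over a sum of opposite infinities;
    reindexing entries always does. *)
Lemma emulvD_perm (R : realType) (N : nat) (M : 'M[R]_N)
    (u v : 'cV[\bar R]_N) :
  is_perm_mx M -> emulv M (u + v) = emulv M u + emulv M v.
Proof.
case/is_perm_mxP => s ->; rewrite !emulv_perm_mx.
by apply/colP => i; rewrite !mxE.
Qed.

Lemma lne_EFin_lty (R : realType) (x : R) : (lne x%:E < +oo)%E.
Proof. by rewrite /lne; case: ifP => _; rewrite ?ltNyr ?ltry. Qed.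

(** Finite terms cancel, and an infinite entry of [v] absorbs them. *)
Lemma to_erealKC (R : realType) (N : nat) (u : 'cV[R]_N) (v : 'cV[\bar R]_N) :
  to_ereal u + (v + to_ereal (- u)) = v.
Proof.
apply/colP => i; rewrite !mxE; case: (v i ord0) => [r| |] //.
by congr EFin; rewrite addrC subrK.
Qed.

Theorem corollary4p5 (R : realType) (N S : nat) (A : finType)
    (H : hmm R N S A) (P : A -> 'M[R]_N)
    (hperm : forall a : A, is_perm_mx (P a))
    (hT : forall a : A, trans H a = P a)
    (w0 : 'cV[R]_N) :
  exists psi : nat -> 'cV[R]_S -> A -> 'cV[\bar R]_N,
    (forall (k : nat) (y : 'cV[R]_S) (a : A) (i : 'I_N),
        (1 <= k)%N -> is_obs y -> (psi k y a i ord0 < +oo)%E) /\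
    (forall (y : nat -> 'cV[R]_S) (a : nat -> A) (w : nat -> 'cV[\bar R]_N),
        (forall k : nat, (1 <= k)%N -> is_obs (y k)) ->
        w 0%N = to_ereal w0 ->
        (forall k : nat, (1 <= k)%N ->
           w k = emulv (P (a k.-1)) (w k.-1) + psi k (y k) (a k.-1)) ->
        forall k : nat, (1 <= k)%N -> w k = opt_logits H y a k).
Proof.
pose logE y := vlog (to_ereal ((emission H)^T *m y)).
pose shift := vlog (to_ereal (init H)) + to_ereal (- w0).
exists (fun k y a => if k == 1%N then emulv (P a) shift + logE y else logE y).
split=> [k y a i _ _|y a w _ w0E wS].
  have logE_lty : (logE y i ord0 < +oo)%E by rewrite !mxE lne_EFin_lty.
  (* Only [k = 1] remains: the correction there is an entry of [shift], moved by [s]. *)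
  case: ifP => // _; case/is_perm_mxP: (hperm a) => s ->.
  rewrite emulv_perm_mx mxE; apply: lte_add_pinfty => //.
  by rewrite !mxE; apply: lte_add_pinfty; rewrite ?lne_EFin_lty ?ltry.
(* The induction starts at time 1, since [w 0] and the optimal logits may differ at time 0. *)
case=> // k _; elim: k => [|k IHk].
  (* Grouping [w0] with [shift] under [P (a 0)] leaves the log of [init H]. *)
  rewrite wS //= w0E addrA -emulvD_perm // to_erealKC.
  by rewrite hT vlog_emulv_vexp.
by rewrite wS // [k.+2.-1]/= IHk [RHS]/= hT vlog_emulv_vexp.
Qed.
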